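(* Let $I$ be a non-degenerate real interval, let $n\ge 2$ be an integer, and let $F:I^n\to I$ be reflexive, symmetric, bisymmetric and partially strictly increasing. Then there exist a non-degenerate real interval $J$ and a continuous strictly monotone bijection $\varphi:I\to J$ such that \[ F(x_1,\dots,x_n)=\varphi^{-1}\!\left(\frac{\varphi(x_1)+\cdots+\varphi(x_n)}{n}\right)\qquad (x_1,\dots,x_n\in I). \] In particular, $F$ is continuous.
   Context: Let $I$ be a real interval and $F:I^n\to I$. $F$ is reflexive if $F(x,\dots,x)=x$ for all $x\in I$. $F$ is symmetric if $F(x_1,\dots,x_n)=F(x_{\sigma(1)},\dots,x_{\sigma(n)})$ for all $x_1,\dots,x_n\in I$ and all permutations $\sigma$ of $\{1,\dots,n\}$. $F$ is bisymmetric if for every $n\times n$ array $(x_{i,j})$ of elements of $I$, \[ F\bigl(F(x_{1,1},\dots,x_{1,n}),\dots,F(x_{n,1},\dots,x_{n,n})\bigr)=F\bigl(F(x_{1,1},\dots,x_{n,1}),\dots,F(x_{1,n},\dots,x_{n,n})\bigr), \] i.e. evaluating first along rows equals evaluating first along columns. $F$ is partially strictly increasing if for every $j\in\{1,\dots,n\}$ and every choice of the remaining variables in $I$, the section $t\mapsto F(x_1,\dots,x_{j-1},t,x_{j+1},\dots,x_n)$ is strictly increasing on $I$. An interval (not necessarily open, closed or bounded) is non-degenerate if it contains more than one point. *)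

(* Defs.v *)
From mathcomp Require Import all_boot all_order all_algebra all_fingroup.
From mathcomp Require Import all_classical all_reals all_analysis.
Import Order.TTheory GRing.Theory Num.Theory numFieldNormedType.Exports.

Set Implicit Arguments.
Unset Strict Implicit.
Unset Printing Implicit Defensive.

Local Open Scope classical_set_scope.
Local Open Scope ring_scope.

Section MeanFunctions.
Context {R : realType}.

Definition nondegenerate_interval (I : set R) : Prop :=
  is_interval I /\ exists x y, [/\ I x, I y & x != y].

Definition cube (n : nat) (I : set R) : set 'rV[R]_n :=
  [set x : 'rV[R]_n | forall i, I (x ord0 i)].

(* A map F : I^n -> I is represented by a total F : 'rV[R]_n -> R with
   set_fun (cube I) I F; the predicates below only constrain F on the cube. *)

Definition reflexive_on (n : nat) (I : set R) (F : 'rV[R]_n -> R) : Prop :=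
  forall x, I x -> F (const_mx x) = x.

Definition symmetric_on (n : nat) (I : set R) (F : 'rV[R]_n -> R) : Prop :=
  forall (x : 'rV[R]_n) (s : 'S_n), cube I x ->
    F (\row_i x ord0 (s i)) = F x.

Definition bisymmetric_on (n : nat) (I : set R) (F : 'rV[R]_n -> R) : Prop :=
  forall X : 'M[R]_n, (forall i j, I (X i j)) ->
    F (\row_i F (\row_j X i j)) = F (\row_j F (\row_i X i j)).

Definition partially_strictly_increasing_on (n : nat) (I : set R)
    (F : 'rV[R]_n -> R) : Prop :=
  forall (j : 'I_n) (x : 'rV[R]_n), (forall i, i != j -> I (x ord0 i)) ->
    {in I &, {homo (fun t => F (\row_i if i == j then t else x ord0 i)) :
      s t / s < t}}.

End MeanFunctions.

(* Main.v *)
Require Import Defs.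
From mathcomp Require Import all_boot all_order all_algebra all_fingroup.
From mathcomp Require Import unstable all_classical all_reals all_analysis.
From mathcomp Require Import zify ring lra.
Import Order.TTheory GRing.Theory Num.Theory numFieldNormedType.Exports.
Local Open Scope classical_set_scope.
Local Open Scope ring_scope.

(** Fix [a < b] in [I].  Iterating [F] on tuples with entries [a] and [b] gives,
    for every [m], points [grid m k], [0 <= k <= n ^ m], obtained by feeding [k]
    copies of [b] and [n ^ m - k] copies of [a] to the [m]-fold iterate of [F].
    Symmetry and bisymmetry make the place of the copies irrelevant
    ([grid_exchange]), so [F] maps the grid points at [k_i / n ^ m] to the grid
    point at the mean of these fractions ([grid_mean]); thus [k / n ^ m] is a
    candidate for the value of the generator at [grid m k].

    Without continuity the grid is not known to be dense in [[a, b]] at first.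
    The function [level], which sends [t] to the supremum of the [k / n ^ m]
    with [grid m k <= t], is nevertheless nondecreasing, maps [[a, b]] onto
    [[0, 1]] ([level_surj]) and turns [F] into the arithmetic mean
    ([level_mean]): each of these facts only needs that [t] is caught between
    two neighbours of every grid.

    The heart of the matter is that [level] is injective ([level_lt]).  If it
    took the same value at [s < t], then for every [r] in [[0, 1]] and every
    [z] at level [r], the whole interval from [F(s, z, .., z)] to
    [F(t, z, .., z)], nonempty by strict monotonicity, would lie at the single
    level [(level s + (n - 1) r) / n].  These intervals are disjoint for
    distinct [r], and each contains a rational: that is an injection of
    [[0, 1]] into the rationals.

    On [[a, b]] every other increasing conjugacy to the arithmetic mean is an
    affine function of [level] ([conjugacy_affine]), so prescribing the values
    0 and 1 at two points of [I] makes the conjugacies of the compact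
    subintervals agree and glues them into a generator on [I]
    ([conjugacy_exists]).  It is increasing with intermediate values, hence
    continuous, and so is its inverse ([increasing_ivt_continuous]); the
    continuity of [F] follows. *)

(** * Splitting an integer into nearly equal parts *)

(** The parts differ by at most one, which yields both bounds needed to recurse:
    [part_le] for all of them, and the strict [part0_lt] for the first. *)
Definition part {n : nat} (k : nat) (i : 'I_n) : nat := ((k + i) %/ n)%N.

(** Hermite's identity: passing from [k] to [k + 1] drops the first part,
    [k / n], and adds [(k + n) / n], which is one more. *)
Lemma sum_part (n k : nat) : (0 < n)%N -> (\sum_(i < n) part k i = k)%N.
Proof.
move=> n0; rewrite /part; elim: k => [|k IH].
  by rewrite big1 // => i _; rewrite add0n divn_small.
rewrite -(big_mkord xpredT (fun i => (k.+1 + i) %/ n)%N).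
rewrite -(big_mkord xpredT (fun i => (k + i) %/ n)%N) in IH.
have E : (\sum_(0 <= i < n) (k.+1 + i) %/ n + k %/ n =
          \sum_(0 <= i < n) (k + i) %/ n + (k + n) %/ n)%N.
  rewrite -(big_nat_recr n 0 (fun i => (k + i) %/ n)%N) //=.
  rewrite big_nat_recl // addn0 addnC; congr addn.
  by apply: eq_bigr => i _; rewrite addSnnS.
by move: E; rewrite IH divnDr // divnn n0; lia.
Qed.

Lemma sum_nat_pred1 (T : finType) (j : T) : (\sum_i (i == j) = 1)%N.
Proof. by rewrite (bigD1 j) //= eqxx big1 // => i /negPf ->. Qed.

Lemma part_le (n m k : nat) (i : 'I_n) :
  (k <= n ^ m.+1 -> part k i <= n ^ m)%N.
Proof.
move=> kn; have n0 : (0 < n)%N by apply: leq_ltn_trans (ltn_ord i).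
rewrite /part -ltnS ltn_divLR // mulSn -expnSr.
by have := ltn_ord i; lia.
Qed.

(** The first part is the smallest one, so it is the one that can be increased
    without exceeding [n ^ m]. *)
Lemma part0_lt (n m k : nat) (n0 : (0 < n)%N) :
  (k < n ^ m.+1 -> part k (Ordinal n0) < n ^ m)%N.
Proof. by rewrite /part /= addn0 ltn_divLR // -expnSr. Qed.

(** * Elementary facts on real sequences *)

Lemma bracket_step (R : realType) (u : nat -> R) (N : nat) (t : R) :
  (0 < N)%N -> u 0%N <= t <= u N ->
  exists2 k, (k < N)%N & u k <= t <= u k.+1.
Proof.
move=> N0 /andP[u0 uN]; elim: N N0 uN => // N IH _ uN.
have [N0|N0] := posnP N; first by exists 0%N => //; rewrite u0 -N0.
have [tN|/ltW Nt] := leP t (u N); last by exists N => //; rewrite Nt.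
by have [k kN kt] := IH N0 tN; exists k => //; exact: ltnW.
Qed.

(** Grids determine a value only up to their mesh: an identity follows once both
    sides are located in an interval of length [c / n ^ m] for every [m]. *)
Lemma eq_dist_geometric (R : realType) (n : nat) (c x y : R) : (1 < n)%N ->
  (forall m, `|x - y| <= c / n%:R ^+ m) -> x = y.
Proof.
move=> n1 H; apply/eqP; rewrite -subr_eq0 -normr_le0 leNgt; apply/negP => d0.
have c0 : 0 <= c by have := H 0%N; rewrite expr0 divr1; apply: le_trans.
pose m := Num.Def.archi_bound (c / `|x - y|).
have := archi_boundP (divr_ge0 c0 (ltW d0)); rewrite ltNge => /negP; apply.
have p : 0 < n%:R ^+ m :> R by rewrite exprn_gt0 // ltr0n ltnW.
apply: le_trans (_ : n%:R ^+ m <= _).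
  by rewrite -natrX ler_nat ltnW // ltn_expl.
by rewrite ler_pdivlMr // mulrC -ler_pdivlMr.
Qed.

Lemma affine_normalized (K : fieldType) (A D p p0 p1 : K) :
  A + D * p0 = 0 -> A + D * p1 = 1 -> p1 - p0 != 0 ->
  A + D * p = (p - p0) / (p1 - p0).
Proof.
move=> E0 E1 nz; apply: (mulIf nz); rewrite divfK //.
have -> : A = - (D * p0) by apply/eqP; rewrite -addr_eq0 E0.
have D1 : D * (p1 - p0) = 1 by rewrite -E1 -[LHS]addr0 -E0; ring.
by rewrite -[RHS]mulr1 -D1; ring.
Qed.

(** Countable sets are Lebesgue-negligible, and the unit segment is not. *)
Lemma no_injection_segment_rat (R : realType) (q : R -> rat) :
  ~ {in `[0%R, 1%R] &, injective q}.
Proof.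
move=> qinj; have /countable_lebesgue_measure0 : countable `[0%R : R, 1%R].
  apply/countable_injP; exists (pickle \o q) => x y.
  rewrite !inE => x01 y01 /= /(pcan_inj pickleK); exact: qinj.
rewrite lebesgue_measure_itv /= lte_fin ltr01 oppr0 adde0 => /eqP.
by rewrite eqe oner_eq0.
Qed.

(** * Continuity of increasing functions *)

(** A value just above [f x] is attained at some [u > x] when [A] has points
    beyond [x], and then [f] stays below it on the left of [u]; when there are
    none, [f x] is a maximum and nothing is to be proved on that side.  The
    endpoints of [A] therefore need no separate treatment. *)
Lemma increasing_ivt_continuous (R : realType) (A : set R) (f : R -> R) :
  (forall x y, A x -> A y -> x < y -> f x < f y) ->
  (forall x y r, A x -> A y -> x < y -> f x <= r <= f y ->
    exists2 u, x <= u <= y & A u /\ f u = r) ->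
  {within A, continuous f}.
Proof.
move=> lt ivt; apply/subspace_continuousP => x Ax; apply/cvgrPdist_lt => e e0.
have le u v : A u -> A v -> u <= v -> f u <= f v.
  by move=> Au Av; rewrite le_eqVlt => /predU1P[-> //|uv]; exact/ltW/lt.
have above : \forall t \near x, A t -> f t < f x + e.
  have [[y [Ay xy]]|nA] := pselect (exists y, A y /\ x < y); last first.
    near=> t => At; apply: le_lt_trans (_ : f x < _); last by rewrite ltrDl.
    by apply: le => //; rewrite leNgt; apply/negP => xt; apply: nA; exists t.
  have [|u /andP[xu uy] [Au fu]] :=
      ivt x y (Num.min (f y) (f x + e / 2)) Ax Ay xy.
    rewrite le_min ge_min lexx /= (ltW (lt _ _ Ax Ay xy)) lerDl.
    by rewrite divr_ge0 // ltW.
  have {}xu : x < u.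
    rewrite lt_neqAle xu andbT; apply/eqP => E; move: fu; rewrite -E => /eqP.
    by rewrite lt_eqF // lt_min lt //= ltrDl divr_gt0.
  near=> t => At; apply: le_lt_trans (_ : f u < _).
    by apply: le => //; apply/ltW; near: t; exact: lt_nbhsl.
  by rewrite fu gt_min; apply/orP; right; lra.
have below : \forall t \near x, A t -> f x - e < f t.
  have [[y [Ay yx]]|nA] := pselect (exists y, A y /\ y < x); last first.
    near=> t => At; apply: lt_le_trans (_ : f x <= _); first by rewrite gtrBl.
    by apply: le => //; rewrite leNgt; apply/negP => xt; apply: nA; exists t.
  have [|u /andP[yu ux] [Au fu]] :=
      ivt y x (Num.max (f y) (f x - e / 2)) Ay Ax yx.
    rewrite ge_max le_max lexx /= (ltW (lt _ _ Ay Ax yx)) gerBl.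
    by rewrite divr_ge0 // ltW.
  have {}ux : u < x.
    rewrite lt_neqAle ux andbT; apply/eqP => E; move: fu; rewrite E => /eqP.
    by rewrite gt_eqF // gt_max lt //= gtrBl divr_gt0.
  near=> t => At; apply: lt_le_trans (_ : f u <= _).
    by rewrite fu lt_max; apply/orP; right; lra.
  by apply: le => //; apply/ltW; near: t; exact: lt_nbhsr.
rewrite near_withinE; apply: filterS2 above below => t lt_fx gt_fx At.
by rewrite distrC ltr_distl gt_fx // lt_fx.
Unshelve. all: by end_near. Qed.

Lemma cvg_within_comp (T U V : topologicalType) (A : set T) (B : set U)
    (f : T -> U) (g : U -> V) (x : T) :
  f @ within A (nbhs x) --> f x -> (forall y, A y -> B (f y)) ->
  g @ within B (nbhs (f x)) --> g (f x) ->
  (g \o f) @ within A (nbhs x) --> g (f x).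
Proof.
move=> fx fAB gx; apply: cvg_comp gx => W WP; have := fx _ WP.
by apply: (@filterS _ (nbhs x)) => y h Ay; exact: h Ay (fAB y Ay).
Qed.

(** * Symmetric bisymmetric means as functions of tuples *)

Definition update {n : nat} {T : Type} (f : 'I_n -> T) (j : 'I_n) (t : T) :
  'I_n -> T := fun i => if i == j then t else f i.

Definition conjugates_to_mean {R : realType} {n : nat} (G : ('I_n -> R) -> R)
    (A : set R) (psi : R -> R) :=
  forall f, (forall i, A (f i)) ->
    psi (G f) = (\sum_i psi (f i)) / n%:R.

(** [G] is [F] read on plain functions ['I_n -> R] instead of row vectors, which
    makes composition with index maps and evaluation along rows and columns
    lighter; the hypotheses are those put on [F]. *)
Section Mean.
Context (R : realType) (I : set R) (n : nat) (G : ('I_n -> R) -> R).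
Hypothesis I_itv : is_interval I.
Hypothesis n_gt1 : (1 < n)%N.
Hypothesis G_in : forall f, (forall i, I (f i)) -> I (G f).
Hypothesis G_refl : forall x, I x -> G (fun=> x) = x.
Hypothesis G_sym : forall f (s : 'S_n), (forall i, I (f i)) -> G (f \o s) = G f.
Hypothesis G_bisym : forall X : 'I_n -> 'I_n -> R, (forall i j, I (X i j)) ->
  G (fun i => G (fun j => X i j)) = G (fun j => G (fun i => X i j)).
Hypothesis G_incr : forall f j s t, (forall i, i != j -> I (f i)) ->
  I s -> I t -> s < t -> G (update f j s) < G (update f j t).

Let n_gt0 : (0 < n)%N := ltnW n_gt1.
Let i0 : 'I_n := Ordinal n_gt0.

(** Monotonicity in each variable gives joint monotonicity: the tuples [h k],
    equal to [g] before position [k] and to [f] from there on, lead from [f] to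
    [g] one coordinate at a time. *)
Lemma mean_le f g : (forall i, I (f i)) -> (forall i, I (g i)) ->
  (forall i, f i <= g i) -> G f <= G g.
Proof.
move=> If Ig fg.
pose h k (i : 'I_n) := if (i < k)%N then g i else f i.
have -> : f = h 0%N by apply/funext.
have -> : g = h n by apply/funext => i; rewrite /h ltn_ord.
have Ih k i : I (h k i) by rewrite /h; case: ifP.
suff H k : (k <= n)%N -> G (h 0%N) <= G (h k) by exact: H.
elim: k => // k IH kn.
apply: le_trans (IH (ltnW kn)) _.
pose j := Ordinal kn.
have -> : h k = update (h k) j (f j).
  apply/funext => i; rewrite /update; case: eqP => // ->.
  by rewrite /h ltnn.
have -> : h k.+1 = update (h k) j (g j).
  apply/funext => i; rewrite /update; case: eqP => [->|/eqP ij].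
    by rewrite /h /= ltnSn.
  by rewrite /h ltnS leq_eqVlt -[(i == k :> nat)]/(i == j) (negPf ij).
have := fg j; rewrite le_eqVlt => /orP[/eqP -> //|lt].
by apply/ltW/G_incr.
Qed.

Lemma mean_lt f g j : (forall i, I (f i)) -> (forall i, I (g i)) ->
  (forall i, f i <= g i) -> f j < g j -> G f < G g.
Proof.
move=> If Ig fg fgj.
have {1}-> : f = update f j (f j).
  by apply/funext => i; rewrite /update; case: eqP => // ->.
apply: lt_le_trans (_ : G (update f j (g j)) <= _); first exact: G_incr.
apply: mean_le => // i; rewrite /update; case: eqP => // ->; exact: lexx.
Qed.

Lemma mean_itv a b f : I a -> I b -> (forall i, a <= f i <= b) ->
  a <= G f <= b.
Proof.
move=> Ia Ib fab.
have If i : I (f i) by apply: I_itv Ia Ib _ (fab i).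
apply/andP; split.
  by rewrite -[leLHS]G_refl //; apply: mean_le => // i; case/andP: (fab i).
by rewrite -[leRHS]G_refl //; apply: mean_le => // i; case/andP: (fab i).
Qed.

Section Grid.
Context (a b : R).
Hypothesis (Ia : I a) (Ib : I b) (ab : a < b).

(** The meaningful indices are [k <= n ^ m]: [grid m k] is the value of the
    [m]-fold iterate of [G] at a tuple with [k] entries [b] and the others [a],
    the entries [b] being spread by [part]. *)
Fixpoint grid (m k : nat) : R :=
  if m is m'.+1 then G (fun i => grid m' (part k i))
  else if k == 0%N then a else b.

Lemma grid_in m k : I (grid m k).
Proof. by elim: m k => [|m IH] k /=; [case: ifP|exact: G_in]. Qed.

(* The unit sits on top of [k] at [p] or at [q], instead of being taken out of
   [k]: this avoids truncated subtraction. *)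
Let exchange m := forall (k : 'I_n -> nat) p q, (forall i, k i <= n ^ m)%N ->
  (k p < n ^ m)%N -> (k q < n ^ m)%N ->
  G (fun i => grid m (k i + (i == p))) = G (fun i => grid m (k i + (i == q))).

(** Tuples of indices with the same sum are joined by moves of a single unit:
    take one from a coordinate where [k] exceeds [l], give it to one where [k]
    is below [l], and the excess of [k] over [l] decreases. *)
Lemma exchange_sum m : exchange m -> forall k l : 'I_n -> nat,
  (forall i, k i <= n ^ m)%N -> (forall i, l i <= n ^ m)%N ->
  (\sum_i k i = \sum_i l i)%N ->
  G (fun i => grid m (k i)) = G (fun i => grid m (l i)).
Proof.
move=> exm k l kN lN.
have [d] := ubnP (\sum_i (k i - l i))%N.
elim: d => // d IH in k kN * => dk skl.
have [p kp|kl] := pickP (fun p => l p < k p)%N; last first.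
  suff kl' : k =1 l by congr G; apply/funext => i; rewrite kl'.
  have kl'' i : (k i <= l i)%N by rewrite leqNgt kl.
  move=> i; apply/eqP; rewrite eqn_leq kl'' /= leqNgt; apply/negP => lt.
  have: (\sum_i k i < \sum_i l i)%N.
    rewrite (bigD1 i) //= [ltnRHS](bigD1 i) //= -addSn leq_add //.
    exact: leq_sum.
  by rewrite skl ltnn.
have [q kq|lk] := pickP (fun q => k q < l q)%N; last first.
  have lk' i : (l i <= k i)%N by rewrite leqNgt lk.
  have: (\sum_i l i < \sum_i k i)%N.
    rewrite (bigD1 p) //= [ltnRHS](bigD1 p) //= -addSn leq_add //.
    exact: leq_sum.
  by rewrite skl ltnn.
have pq : p != q by apply/eqP => E; move: kp kq; rewrite E; lia.
(* [k'] is what [k] and its modification have in common. *)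
pose k' i := (k i - (i == p))%N.
have kE i : k i = (k' i + (i == p))%N.
  by rewrite /k'; case: (i =P p) => [->|_]; lia.
have k'q : k' q = k q by rewrite /k' eq_sym (negPf pq) subn0.
have k'N i : (k' i <= n ^ m)%N by apply: leq_trans (kN i); rewrite leq_subr.
transitivity (G (fun i => grid m (k' i + (i == p)))).
  by congr G; apply/funext => i; rewrite -kE.
rewrite (exm k' p q) //; last 2 first.
- by rewrite /k' eqxx; have := kN p; lia.
- by rewrite k'q (leq_trans kq).
apply: IH.
- move=> i; case: (i =P q) => [->|_]; last by rewrite addn0.
  by rewrite k'q addn1 (leq_trans kq).
- move: dk; rewrite ltnS; apply: leq_trans.
  rewrite (bigD1 p) //= [ltnRHS](bigD1 p) //= -addSn leq_add //.
    by rewrite (negPf pq) /k' eqxx; lia.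
  apply: leq_sum => i ip; case: (i =P q) => [->|_]; first by rewrite k'q; lia.
  by rewrite /k' (negPf ip); lia.
- rewrite -skl big_split /= (eq_bigr _ (fun i _ => kE i)).
  rewrite big_split /=; congr addn.
  by rewrite !sum_nat_pred1.
Qed.

(** For [m = 0] the coordinates [p] and [q] carry the indices 0 and 1, and the
    exchange is a transposition of the arguments.  In the inductive step write
    the indices as the row sums of a matrix; bisymmetry lets one evaluate along
    columns first.  If both positions of the unit are in the same column, the
    two matrices differ in that column only, and there by an exchange for
    [m]. *)
Lemma grid_exchange m : exchange m.
Proof.
elim: m => [|m IH] k p q kN kp kq.
  move: kp kq; rewrite expn0 !ltnS !leqn0 => /eqP kp /eqP kq.
  rewrite -(G_sym (fun i => grid 0 (k i + (i == q))) (tperm p q)); last first.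
    by move=> i; exact: grid_in.
  congr G; apply/funext => i /=; congr (if _ == _ then _ else _).
  case: tpermP => [->|->|/eqP ip /eqP iq].
  - by rewrite kp kq !eqxx.
  - by rewrite kp kq; case: eqVneq.
  - by rewrite (negPf ip) (negPf iq).
(* The unit added to row [r] always goes to column [i0]. *)
pose X r i j := grid m (part (k i) j + ((i == r) && (j == i0))).
have row r i : (k r < n ^ m.+1)%N ->
    grid m.+1 (k i + (i == r)) = G (X r i).
  move=> kr; rewrite /X [LHS]/=; apply: exchange_sum => //.
  - move=> j; apply: part_le; case: eqP => [->|_]; first by rewrite addn1.
    by rewrite addn0.
  - move=> j; case: (i =P r) => [->|_]; last by rewrite addn0 part_le.
    case: (j =P i0) => [->|_]; last by rewrite addn0 part_le.
    by rewrite addn1 part0_lt.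
  - rewrite sum_part // big_split /= sum_part //; congr addn.
    case: (i =P r) => _; last by rewrite big1.
    exact/esym/(sum_nat_pred1 _ i0).
have swap r : (k r < n ^ m.+1)%N ->
    G (fun i => grid m.+1 (k i + (i == r))) = G (fun j => G (fun i => X r i j)).
  move=> kr; rewrite -G_bisym; last by move=> *; exact: grid_in.
  by congr G; apply/funext => i; rewrite row.
rewrite !swap //; congr G; apply/funext => j; rewrite /X.
case: (j =P i0) => [->|_]; last first.
  by congr G; apply/funext => i; rewrite !andbF.
transitivity (G (fun i => grid m (part (k i) i0 + (i == p)))).
  by congr G; apply/funext => i; rewrite andbT.
rewrite (IH _ p q) ?part0_lt //; last by move=> i; exact: part_le.
by congr G; apply/funext => i; rewrite andbT.
Qed.

(** The tuple defining [grid m.+1] is just one of those with its index sum. *)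
Lemma grid_mean m (k : 'I_n -> nat) : (forall i, k i <= n ^ m)%N ->
  G (fun i => grid m (k i)) = grid m.+1 (\sum_i k i).
Proof.
move=> kN; apply: exchange_sum => //; first exact: grid_exchange.
- move=> i; apply: part_le; rewrite expnS -[X in (X * _)%N]card_ord.
  by rewrite -sum_nat_const; apply: leq_sum.
- by rewrite sum_part.
Qed.

(** The grid is a function of the fraction [k / n ^ m] alone, by reflexivity:
    the parts of a multiple of [n] are all equal. *)
Lemma grid_refine m j k : grid (m + j) (k * n ^ j) = grid m k.
Proof.
elim: j => [|j IH]; first by rewrite addn0 muln1.
rewrite addnS /= -IH -[RHS]G_refl; last exact: grid_in.
congr G; apply/funext => i; rewrite /part expnSr mulnA divnMDl //.
by rewrite divn_small // addn0.
Qed.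

Lemma grid_max m : grid m (n ^ m) = b.
Proof. by have := grid_refine 0 m 1; rewrite add0n mul1n. Qed.

Lemma grid_min m : grid m 0 = a.
Proof. by have := grid_refine 0 m 0; rewrite add0n mul0n. Qed.

Lemma grid_ltS m k : (k < n ^ m)%N -> grid m k < grid m k.+1.
Proof.
elim: m k => [|m IH] k kN; first by case: k kN.
have kN' := part0_lt _ _ _ n_gt0 kN.
have -> : grid m.+1 k.+1 = G (fun i => grid m (part k i + (i == i0))).
  rewrite grid_mean => [|i]; last first.
    case: eqP => [->|_]; first by rewrite addn1.
    by rewrite addn0 part_le // ltnW.
  by rewrite big_split /= sum_part // sum_nat_pred1 addn1.
apply: (mean_lt _ _ i0) => [i|i|i|]; try exact: grid_in.
  case: eqP => [->|_]; last by rewrite addn0.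
  by rewrite addn1 ltW // IH.
by rewrite eqxx addn1 IH.
Qed.

Lemma grid_lt m k l : (k < l <= n ^ m)%N -> grid m k < grid m l.
Proof.
case/andP; elim: l => // l IH; rewrite ltnS leq_eqVlt => kl lN.
have {kl} [->|kl] := predU1P kl; first exact: grid_ltS.
by apply: lt_trans (IH kl (ltnW lN)) _; exact: grid_ltS.
Qed.

Lemma frac_leE m k m' k' : (k%:R / n%:R ^+ m <= k'%:R / n%:R ^+ m' :> R) =
  (k * n ^ m' <= k' * n ^ m)%N.
Proof.
have p i : 0 < (n ^ i)%:R :> R by rewrite ltr0n expn_gt0 n_gt0.
by rewrite -!natrX ler_pdivrMr // mulrAC ler_pdivlMr // -!natrM ler_nat.
Qed.

Lemma grid_frac_le m k m' k' : (k' <= n ^ m')%N ->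
  k%:R / n%:R ^+ m <= k'%:R / n%:R ^+ m' :> R -> grid m k <= grid m' k'.
Proof.
move=> kN; rewrite frac_leE => le.
rewrite -(grid_refine m m' k) -(grid_refine m' m k') addnC.
move: le; rewrite leq_eqVlt => /predU1P[-> //|lt].
by apply/ltW/grid_lt; rewrite lt expnD leq_mul2r kN orbT.
Qed.

Lemma grid_frac_lt m k m' k' : (k' <= n ^ m')%N ->
  k%:R / n%:R ^+ m < k'%:R / n%:R ^+ m' :> R -> grid m k < grid m' k'.
Proof.
move=> kN; rewrite ltNge frac_leE -ltnNge => lt.
rewrite -(grid_refine m m' k) -(grid_refine m' m k') addnC.
by apply: grid_lt; rewrite lt expnD leq_mul2r kN orbT.
Qed.

Lemma grid_itv m k : a <= grid m k <= b.
Proof.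
elim: m k => [|m IH] k; last exact: mean_itv.
by rewrite /=; case: ifP => _; rewrite lexx (ltW ab).
Qed.

Lemma grid_bracket m t : a <= t <= b ->
  exists2 k, (k < n ^ m)%N & grid m k <= t <= grid m k.+1.
Proof.
move=> tab; apply: bracket_step; first by rewrite expn_gt0 n_gt0.
by rewrite grid_min grid_max.
Qed.

Let pow_gt0 m : 0 < n%:R ^+ m :> R.
Proof. by rewrite exprn_gt0 // ltr0n. Qed.

Definition level (t : R) : R :=
  sup [set r | exists m k, [/\ (k <= n ^ m)%N, grid m k <= t &
                              r = k%:R / n%:R ^+ m]].

Lemma level_ge m k t : (k <= n ^ m)%N -> grid m k <= t ->
  k%:R / n%:R ^+ m <= level t.
Proof.
move=> kN kt; apply: ub_le_sup; last by exists m, k.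
exists 1 => _ [m' [k' [kN' _ ->]]].
by rewrite ler_pdivrMr // mul1r -natrX ler_nat.
Qed.

Lemma level_le m k t : (k <= n ^ m)%N -> a <= t -> t <= grid m k ->
  level t <= k%:R / n%:R ^+ m.
Proof.
move=> kN at_ tk; apply: ge_sup.
  by exists 0, 0%N, 0%N; rewrite mul0r.
move=> _ [m' [k' [kN' kt ->]]]; rewrite leNgt; apply/negP => lt.
have := grid_frac_lt _ _ _ _ kN' lt.
by rewrite ltNge (le_trans kt tk).
Qed.

Lemma level_homo s t : a <= s -> s <= t -> level s <= level t.
Proof.
move=> as_ st; apply: ge_sup; first by exists 0, 0%N, 0%N; rewrite mul0r.
move=> _ [m [k [kN kt ->]]]; apply: level_ge => //; exact: le_trans st.
Qed.

(** Bracketing every [f i] between grid points of indices [k i] and [(k i).+1]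
    brackets [G f] between the grid points of indices [S] and [S + n] of the
    next grid, [S] being the sum of the [k i]; the two fractions differ by
    [1 / n ^ m], and the mean of the levels is between them as well. *)
Lemma level_mean : conjugates_to_mean G [set t | a <= t <= b] level.
Proof.
move=> f fab; apply: (eq_dist_geometric _ n 1) => // m.
have /choice[k kP] : forall i, exists k,
    (k < n ^ m)%N /\ grid m k <= f i <= grid m k.+1.
  by move=> i; have [k] := grid_bracket m (f i) (fab i); exists k.
have If i : I (f i) by apply: I_itv Ia Ib _ (fab i).
have kN i : (k i <= n ^ m)%N by case: (kP i) => /ltnW.
have kSN i : ((k i).+1 <= n ^ m)%N by case: (kP i).
pose S := (\sum_i k i)%N.
have SE : (\sum_i (k i).+1 = S + n)%N.
  under eq_bigr do rewrite -addn1.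
  by rewrite big_split /= sum_nat_const card_ord muln1.
have sumN (l : 'I_n -> nat) : (forall i, l i <= n ^ m)%N ->
    (\sum_i l i <= n ^ m.+1)%N.
  move=> lN; rewrite expnS -[X in (X * _)%N]card_ord.
  by rewrite -sum_nat_const; apply: leq_sum.
have lo : S%:R / n%:R ^+ m.+1 <= level (G f).
  apply: level_ge; first exact: sumN.
  rewrite -grid_mean //; apply: mean_le => // [i|i]; first exact: grid_in.
  by case: (kP i) => _ /andP[].
have hi : level (G f) <= (S + n)%:R / n%:R ^+ m.+1.
  rewrite -SE; apply: level_le; first exact: sumN.
    by case/andP: (mean_itv _ _ _ Ia Ib fab).
  rewrite -grid_mean //; apply: mean_le => // [i|i]; first exact: grid_in.
  by case: (kP i) => _ /andP[].
have lo' : S%:R / n%:R ^+ m <= \sum_i level (f i).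
  rewrite natr_sum mulr_suml; apply: ler_sum => i _.
  by apply: level_ge => //; case: (kP i) => _ /andP[].
have hi' : \sum_i level (f i) <= (S + n)%:R / n%:R ^+ m.
  rewrite -SE natr_sum mulr_suml; apply: ler_sum => i _.
  apply: level_le => //; first by case/andP: (fab i).
  by case: (kP i) => _ /andP[].
have nR : 0 < n%:R :> R by rewrite ltr0n.
have ES : S%:R / n%:R ^+ m.+1 = S%:R / n%:R ^+ m / n%:R :> R.
  by rewrite exprSr invfM mulrA.
have ESn : (S + n)%:R / n%:R ^+ m.+1 = S%:R / n%:R ^+ m.+1 + 1 / n%:R ^+ m :> R.
  rewrite natrD mulrDl; congr (_ + _).
  by rewrite exprS invfM mulrA divff // lt0r_neq0.
have ESn' : (S + n)%:R / n%:R ^+ m / n%:R = (S + n)%:R / n%:R ^+ m.+1 :> R.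
  by rewrite exprSr invfM mulrA.
move: lo hi; rewrite ESn ES => lo hi.
move: lo'; rewrite -(ler_pM2r (x := n%:R^-1)) ?invr_gt0 // => lo'.
move: hi'; rewrite -(ler_pM2r (x := n%:R^-1)) ?invr_gt0 // ESn' ESn ES.
by move=> hi'; rewrite ler_norml; apply/andP; split; lra.
Qed.

(** The supremum of the grid points whose fraction is at most [r] is at level
    [r], as both are caught between the same consecutive fractions. *)
Lemma level_surj r : 0 <= r <= 1 -> exists2 t, a <= t <= b & level t = r.
Proof.
move=> r01.
pose A := [set x | exists m k, [/\ (k <= n ^ m)%N, k%:R / n%:R ^+ m <= r &
                                  x = grid m k]].
have Ab : ubound A b by move=> _ [m [k [_ _ ->]]]; case/andP: (grid_itv m k).
have Aa : A a.
  by exists 0%N, 0%N; split=> //; rewrite mul0r; case/andP: r01.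
have supA x : A x -> x <= sup A by move=> Ax; apply: ub_le_sup => //; exists b.
have sab : a <= sup A <= b by rewrite supA //=; apply: ge_sup => //; exists a.
exists (sup A) => //; apply: (eq_dist_geometric _ n 1) => // m.
have [k kN /andP[kr rk]] : exists2 k, (k < n ^ m)%N &
    k%:R / n%:R ^+ m <= r <= k.+1%:R / n%:R ^+ m.
  apply: (bracket_step _ (fun k => k%:R / n%:R ^+ m)).
    by rewrite expn_gt0 n_gt0.
  by rewrite natrX mul0r divff // lt0r_neq0.
have lo : k%:R / n%:R ^+ m <= level (sup A).
  by apply: level_ge; [exact: ltnW|apply: supA; exists m, k; rewrite ltnW].
have hi : level (sup A) <= k.+1%:R / n%:R ^+ m.
  apply: level_le => //; first by case/andP: sab.
  apply: ge_sup; first by exists a.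
  move=> _ [m' [k' [_ kr' ->]]]; apply: grid_frac_le => //.
  exact: le_trans kr' rk.
move: hi rk; rewrite -natr1 mulrDl => hi rk.
by rewrite ler_norml; apply/andP; split; lra.
Qed.

Lemma conjugates_to_mean_grid psi m k :
  conjugates_to_mean G [set t | a <= t <= b] psi -> (k <= n ^ m)%N ->
  psi (grid m k) = psi a + (psi b - psi a) * (k%:R / n%:R ^+ m).
Proof.
move=> psiM; elim: m k => [|m IH] k kN.
  rewrite expr0 divr1; case: k kN => [|[|//]] _ /=.
    by rewrite mulr0 addr0.
  by rewrite mulr1 addrC subrK.
rewrite /= psiM; last by move=> i; exact: grid_itv.
rewrite (eq_bigr (fun i =>
  psi a + (psi b - psi a) * ((part k i)%:R / n%:R ^+ m))).
  rewrite big_split /= sumr_const card_ord -mulr_sumr -mulr_suml -natr_sum.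
  rewrite sum_part // mulrDl -[psi a *+ n]mulr_natr mulfK ?pnatr_eq0 -?lt0n //.
  by rewrite exprSr invfM !mulrA.
by move=> i _; rewrite IH // part_le.
Qed.

(** A conjugacy is affine in [k / n ^ m] along the grid, and [psi] and [level]
    are both squeezed between consecutive grid points. *)
Lemma level_unique psi t :
  {in `[a, b] &, {homo psi : x y / x <= y}} ->
  conjugates_to_mean G [set t | a <= t <= b] psi -> a <= t <= b ->
  psi t = psi a + (psi b - psi a) * level t.
Proof.
move=> psi_le psiM tab; apply: (eq_dist_geometric _ n (psi b - psi a)) => // m.
have [k kN /andP[kt tk]] := grid_bracket m t tab.
have d0 : 0 <= psi b - psi a.
  by rewrite subr_ge0; apply: psi_le; rewrite ?in_itv /= ?lexx ltW.
have lo : psi a + (psi b - psi a) * (k%:R / n%:R ^+ m) <= psi t.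
  rewrite -conjugates_to_mean_grid //; last exact: ltnW.
  by apply: psi_le => //; rewrite in_itv /= ?grid_itv.
have hi : psi t <= psi a + (psi b - psi a) * (k.+1%:R / n%:R ^+ m).
  rewrite -conjugates_to_mean_grid //.
  by apply: psi_le => //; rewrite in_itv /= ?grid_itv.
have lo' : (psi b - psi a) * (k%:R / n%:R ^+ m) <= (psi b - psi a) * level t.
  by apply: ler_wpM2l => //; apply: level_ge => //; exact: ltnW.
have hi' : (psi b - psi a) * level t <= (psi b - psi a) * (k.+1%:R / n%:R ^+ m).
  by apply: ler_wpM2l => //; apply: level_le => //; case/andP: tab.
move: hi hi'; rewrite -natr1 [(k%:R + 1) / _]mulrDl mulrDr mul1r => hi hi'.
by rewrite ler_norml; apply/andP; split; lra.
Qed.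

(** A common level of [s < t] would be carried by [G] to uncountably many
    disjoint nondegenerate intervals, one for each level [r] of the remaining
    variables; [q] picks a rational in each. *)
Lemma level_lt s t : a <= s -> s < t -> t <= b -> level s < level t.
Proof.
move=> as_ st tb; rewrite lt_neqAle (level_homo _ _ as_ (ltW st)) andbT.
apply/eqP => pst.
have sab : a <= s <= b by rewrite as_ (le_trans (ltW st)).
have tab : a <= t <= b by rewrite tb (le_trans as_ (ltW st)).
have /choice[z zP] : forall r, exists z,
    0 <= r <= 1 -> a <= z <= b /\ level z = r.
  move=> r; have [/level_surj[z zab zr]|] := boolP (0 <= r <= 1).
    by exists z.
  by exists a.
pose g x r := update (fun=> z r) i0 x.
have gab x r : 0 <= r <= 1 -> a <= x <= b -> forall i, a <= g x r i <= b.
  by move=> /zP[zab _] xab i; rewrite /g /update; case: ifP.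
have pg x r : 0 <= r <= 1 -> a <= x <= b ->
    level (G (g x r)) = (level x + n.-1%:R * r) / n%:R.
  move=> r01 xab; rewrite level_mean; last exact: gab.
  congr (_ / _); rewrite (bigD1 i0) //= {1}/g /update eqxx; congr (_ + _).
  rewrite (eq_bigr (fun=> r)); last first.
    by move=> i /negPf ii0; rewrite /g /update ii0; case: (zP r r01).
  by rewrite sumr_const cardC1 card_ord mulr_natl.
have I_ab x : a <= x <= b -> I x by exact: I_itv.
have lt_g r : 0 <= r <= 1 -> G (g s r) < G (g t r).
  move=> r01; apply: G_incr => //; try exact: I_ab.
  by move=> i _; case: (zP r r01) => /I_ab.
have /choice[q qP] : forall r, exists q : rat, 0 <= r <= 1 ->
    G (g s r) < ratr q < G (g t r).
  move=> r; have [r01|] := boolP (0 <= r <= 1); last by exists 0.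
  have [q] := rat_in_itvoo (lt_g r r01).
  by rewrite in_itv /=; exists q.
apply: (no_injection_segment_rat _ q) => x y.
rewrite !in_itv /= => x01 y01 qxy.
(* So [r] can be recovered from [q r]. *)
have pq r : 0 <= r <= 1 -> level (ratr (q r)) = (level s + n.-1%:R * r) / n%:R.
  move=> r01; have /andP[sq qt] := qP r r01.
  have ag : a <= G (g s r).
    by case/andP: (mean_itv _ _ _ Ia Ib (gab s r r01 sab)).
  apply/le_anti/andP; split.
    rewrite pst -pg //; apply: level_homo; last exact: ltW.
    exact: le_trans ag (ltW sq).
  by rewrite -pg //; apply: level_homo => //; exact: ltW.
have := pq x x01; rewrite qxy pq // => /(mulIf _).
rewrite invr_neq0 ?pnatr_eq0 -?lt0n // => /(_ isT) /addrI /mulfI E.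
by apply/esym/E; rewrite pnatr_eq0; lia.
Qed.

End Grid.

(** * From compact intervals to the whole interval *)

Definition increasing_conjugacy (A : set R) (psi : R -> R) :=
  (forall x y, A x -> A y -> x < y -> psi x < psi y) /\
  conjugates_to_mean G A psi.

Lemma segment_subset a b : I a -> I b -> [set t | a <= t <= b] `<=` I.
Proof. by move=> Ia Ib t; exact: I_itv. Qed.

Lemma increasing_conjugacy_sub (A B : set R) psi : A `<=` B ->
  increasing_conjugacy B psi -> increasing_conjugacy A psi.
Proof.
move=> AB [lt M]; split=> [x y /AB Bx /AB By|f fA]; first exact: lt.
by apply: M => i; exact: AB.
Qed.

Lemma level_conjugacy a b : I a -> I b -> a < b ->
  increasing_conjugacy [set t | a <= t <= b] (level a b).
Proof.
move=> Ia Ib ab; split; last exact: level_mean.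
by move=> x y /andP[ax xb] /andP[ay yb] xy; exact: level_lt.
Qed.

Lemma conjugacy_affine a b psi : I a -> I b -> a < b ->
  increasing_conjugacy [set t | a <= t <= b] psi ->
  forall t, a <= t <= b -> psi t = psi a + (psi b - psi a) * level a b t.
Proof.
move=> Ia Ib ab [lt M] t tab; apply: level_unique => // x y.
rewrite !in_itv /= => xab yab; rewrite le_eqVlt => /predU1P[-> //|xy].
exact/ltW/lt.
Qed.

(** On [[s, t]] the conjugacy is an affine image of [level], which maps onto
    [[0, 1]]. *)
Lemma conjugacy_ivt (psi : R -> R) s t r : increasing_conjugacy I psi ->
  I s -> I t -> s < t -> psi s <= r <= psi t ->
  exists2 u, s <= u <= t & psi u = r.
Proof.
move=> psiP Is It st rst.
have lt : psi s < psi t by apply: psiP.1.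
have psi_st := increasing_conjugacy_sub _ _ _ (segment_subset _ _ Is It) psiP.
have d0 : 0 < psi t - psi s by rewrite subr_gt0.
have r01 : 0 <= (r - psi s) / (psi t - psi s) <= 1.
  by rewrite ler_pdivlMr // ler_pdivrMr // mul0r mul1r subr_ge0 lerD2r.
have [u ust ur] := level_surj _ _ Is It st _ r01.
exists u => //; rewrite (conjugacy_affine s t) // ur mulrC divfK ?lt0r_neq0 //.
by rewrite addrC subrK.
Qed.

Section Glue.
Context (x0 y0 : R).
Hypothesis (Ix0 : I x0) (Iy0 : I y0) (x0y0 : x0 < y0).

Definition normalized_conjugacy (a b : R) (psi : R -> R) :=
  [/\ increasing_conjugacy [set t | a <= t <= b] psi, psi x0 = 0 & psi y0 = 1].

Lemma normalized_conjugacy_exists a b : I a -> I b -> a <= x0 -> y0 <= b ->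
  exists psi, normalized_conjugacy a b psi.
Proof.
move=> Ia Ib ax yb.
have ab : a < b by apply: le_lt_trans ax (lt_le_trans x0y0 yb).
have [lt M] := level_conjugacy a b Ia Ib ab.
have d0 : 0 < level a b y0 - level a b x0.
  rewrite subr_gt0; apply: lt => //=.
    by rewrite ax (le_trans (ltW x0y0)).
  by rewrite yb (le_trans ax (ltW x0y0)).
exists (fun t => (level a b t - level a b x0) / (level a b y0 - level a b x0)).
split; last 2 first.
- by rewrite subrr mul0r.
- by rewrite divff // lt0r_neq0.
split=> [x y xab yab xy|f fab].
  by rewrite ltr_pM2r ?invr_gt0 // ltrD2r; exact: lt.
rewrite M // -mulr_suml big_split /= sumr_const card_ord mulrAC.
congr (_ / _); rewrite mulrDl; congr (_ + _).
by rewrite -[X in X / _]mulr_natr mulfK // pnatr_eq0 -lt0n.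
Qed.

Lemma normalized_conjugacy_unique a b psi1 psi2 : I a -> I b ->
  a <= x0 -> y0 <= b ->
  normalized_conjugacy a b psi1 -> normalized_conjugacy a b psi2 ->
  forall t, a <= t <= b -> psi1 t = psi2 t.
Proof.
move=> Ia Ib ax yb.
have ab : a < b by apply: le_lt_trans ax (lt_le_trans x0y0 yb).
have xab : a <= x0 <= b by rewrite ax (le_trans (ltW x0y0)).
have yab : a <= y0 <= b by rewrite yb (le_trans ax (ltW x0y0)).
have p_neq : level a b y0 - level a b x0 != 0.
  by rewrite subr_eq0 gt_eqF //; apply: (level_conjugacy _ _ Ia Ib ab).1.
suff H psi : normalized_conjugacy a b psi -> forall t, a <= t <= b ->
    psi t = (level a b t - level a b x0) / (level a b y0 - level a b x0).
  by move=> psi1P psi2P t tab; rewrite (H psi1) // (H psi2).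
move=> [psiP psi_x0 psi_y0] t tab.
have E := conjugacy_affine _ _ _ Ia Ib ab psiP.
rewrite E //; apply: affine_normalized => //; by rewrite -E.
Qed.

(** The value at [t] is read off a normalized conjugacy of the segment spanned
    by [t], [x0] and [y0]; by uniqueness any larger segment gives the same
    value, so that finitely many points can be treated inside one common
    segment. *)
Lemma conjugacy_exists : exists psi, increasing_conjugacy I psi.
Proof.
have Imin t : I t -> I (Num.min t x0) by move=> It; rewrite minEle; case: ifP.
have Imax t : I t -> I (Num.max t y0) by move=> It; rewrite maxEle; case: ifP.
have min_x0 t : Num.min t x0 <= x0 by rewrite ge_min lexx orbT.
have max_y0 t : y0 <= Num.max t y0 by rewrite le_max lexx orbT.
have /choice[psi psiP] : forall t, exists psi, I t ->
    normalized_conjugacy (Num.min t x0) (Num.max t y0) psi.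
  move=> t; have [It|nIt] := pselect (I t); last by exists id.
  have [psi psiP] :=
    normalized_conjugacy_exists _ _ (Imin t It) (Imax t It)
      (min_x0 t) (max_y0 t).
  by exists psi.
pose Phi t := psi t t.
have PhiE a b : I a -> I b -> a <= x0 -> y0 <= b ->
    exists2 chi, increasing_conjugacy [set t | a <= t <= b] chi &
      forall t, a <= t <= b -> Phi t = chi t.
  move=> Ia Ib ax yb.
  have [chi [chiP chi_x0 chi_y0]] :=
    normalized_conjugacy_exists _ _ Ia Ib ax yb.
  exists chi => // t tab; have It : I t by exact: I_itv tab.
  apply: (normalized_conjugacy_unique (Num.min t x0) (Num.max t y0) (psi t)).
  - exact: Imin.
  - exact: Imax.
  - exact: min_x0.
  - exact: max_y0.
  - exact: psiP.
  - split=> //; apply: increasing_conjugacy_sub chiP => u /= /andP[tu ut].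
    case/andP: tab => at_ tb.
    rewrite (le_trans _ tu) ?le_min ?at_ //.
    by rewrite (le_trans ut) // ge_max tb.
  - by rewrite ge_min le_max !lexx.
exists Phi; split=> [x y Ix Iy xy|f fI].
  have [chi [lt _] chiE] :=
    PhiE _ _ (Imin x Ix) (Imax y Iy) (min_x0 x) (max_y0 y).
  have xab : Num.min x x0 <= x <= Num.max y y0.
    by rewrite ge_min lexx le_max (ltW xy).
  have yab : Num.min x x0 <= y <= Num.max y y0.
    by rewrite ge_min (ltW xy) le_max lexx.
  by rewrite !chiE //; exact: lt.
pose a := \big[Num.min/x0]_i f i; pose b := \big[Num.max/y0]_i f i.
have Ia : I a.
  by rewrite /a; elim/big_ind: _ => // x y Ix Iy; rewrite minEle; case: ifP.
have Ib : I b.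
  by rewrite /b; elim/big_ind: _ => // x y Ix Iy; rewrite maxEle; case: ifP.
have fab i : a <= f i <= b by rewrite bigmin_le_cond //= le_bigmax_cond.
have [chi [_ M] chiE] :=
  PhiE a b Ia Ib (bigmin_le_id _ _ _ _) (bigmax_ge_id _ _ _ _).
rewrite chiE; last exact: mean_itv.
by rewrite M //; congr (_ / _); apply: eq_bigr => i _; rewrite chiE.
Qed.

End Glue.
End Mean.

Theorem theorem1p1 (R : realType) (I : set R) (n : nat) (F : 'rV[R]_n -> R)
    (hI : nondegenerate_interval I) (hn : (2 <= n)%N)
    (F_fun : set_fun (cube I) I F)
    (F_refl : reflexive_on I F)
    (F_sym : symmetric_on I F)
    (F_bisym : bisymmetric_on I F)
    (F_incr : partially_strictly_increasing_on I F) :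
  (exists (J : set R) (phi : R -> R),
    [/\ nondegenerate_interval J,
        {within I, continuous phi},
        strict_monotonic I phi,
        set_bij I J phi &
        forall x : 'rV[R]_n, cube I x ->
          F x = 'pinv_(fun=> 0) I phi ((\sum_(i < n) phi (x ord0 i)) / n%:R)])
  /\ {within cube I, continuous F}.
Proof.
have [I_itv [x0 [y0 [Ix0 Iy0 x0y0]]]] := hI.
wlog {x0y0} x0y0 : x0 y0 Ix0 Iy0 / x0 < y0.
  by move=> H; move: x0y0; rewrite neq_lt => /orP[/H|/H]; exact.
pose G (f : 'I_n -> R) := F (\row_i f i).
have cubeP f : (forall i, I (f i)) -> cube I (\row_i f i).
  by move=> If i; rewrite mxE.
have GE x : F x = G (x ord0).
  by congr F; apply/rowP => i; rewrite mxE.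
have G_in f : (forall i, I (f i)) -> I (G f).
  by move=> /cubeP; exact: F_fun.
have G_refl x : I x -> G (fun=> x) = x.
  by move=> /F_refl {2}<-; congr F; apply/rowP => i; rewrite !mxE.
have G_sym f (s : 'S_n) : (forall i, I (f i)) -> G (f \o s) = G f.
  move=> /cubeP If; rewrite /G -(F_sym _ s If).
  by congr F; apply/rowP => i; rewrite !mxE.
have G_bisym (X : 'I_n -> 'I_n -> R) : (forall i j, I (X i j)) ->
    G (fun i => G (fun j => X i j)) = G (fun j => G (fun i => X i j)).
  move=> IX; have := F_bisym (\matrix_(i, j) X i j).
  have E1 : \row_i G (fun j => X i j) =
      \row_i F (\row_j (\matrix_(i, j) X i j) i j).
    by apply/rowP => i; rewrite !mxE; congr F; apply/rowP => j; rewrite !mxE.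
  have E2 : \row_j G (fun i => X i j) =
      \row_j F (\row_i (\matrix_(i, j) X i j) i j).
    by apply/rowP => i; rewrite !mxE; congr F; apply/rowP => j; rewrite !mxE.
  rewrite -E1 -E2; apply => i j; by rewrite mxE.
have G_incr f j s t : (forall i, i != j -> I (f i)) -> I s -> I t -> s < t ->
    G (update f j s) < G (update f j t).
  move=> If Is It st.
  have := F_incr j (\row_i f i) _ s t (mem_set Is) (mem_set It) st.
  have E u : (\row_i if i == j then u else (\row_i f i) ord0 i) =
             \row_i update f j u i :> 'rV[R]_n.
    by apply/rowP => i; rewrite !mxE.
  by rewrite /= !E; apply => i ij; rewrite mxE; exact: If.
have [phi phiP] :=
  conjugacy_exists R I n G I_itv hn G_in G_refl G_sym G_bisym G_incr
    x0 y0 Ix0 Iy0 x0y0.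
have ivt := conjugacy_ivt R I n G I_itv hn G_in G_refl G_sym G_bisym G_incr phi.
have [phi_lt phi_mean] := phiP.
have phi_inj : {in I &, injective phi}.
  move=> x y /set_mem Ix /set_mem Iy E; case: (ltrgtP x y) => // xy.
    by have := phi_lt _ _ Ix Iy xy; rewrite E ltxx.
  by have := phi_lt _ _ Iy Ix xy; rewrite E ltxx.
pose g := 'pinv_(fun=> 0) I phi.
have gK x : I x -> g (phi x) = x by move=> Ix; exact: pinvKV (mem_set Ix).
(* [F] is [g] after [M], and [M] takes its values in the domain of [g]. *)
pose M (x : 'rV[R]_n) := (\sum_(i < n) phi (x ord0 i)) / n%:R.
have ME x : cube I x -> M x = phi (F x) by move=> Ix; rewrite GE phi_mean.
have FE x : cube I x -> F x = g (M x).
  by move=> Ix; rewrite ME // gK //; exact: F_fun.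
have phi_cont : {within I, continuous phi}.
  apply: increasing_ivt_continuous => // x y r Ix Iy xy rxy.
  have [u uxy ur] := ivt x y r phiP Ix Iy xy rxy.
  by exists u => //; split=> //; exact: I_itv Ix Iy _ uxy.
have J_itv : is_interval (phi @` I).
  move=> _ _ [x Ix <-] [y Iy <-] r rxy; case: (ltrgtP x y) => xy.
  - have [u uxy <-] := ivt x y r phiP Ix Iy xy rxy.
    by exists u => //; exact: I_itv Ix Iy _ uxy.
  - have := phi_lt _ _ Iy Ix xy; case/andP: rxy => xr ry.
    by rewrite ltNge (le_trans xr ry).
  - by exists x => //; apply/le_anti; rewrite {2}xy.
have g_cont : {within phi @` I, continuous g}.
  have g_lt x y : I x -> I y -> phi x < phi y -> x < y.
    move=> Ix Iy xy; rewrite ltNge le_eqVlt; apply/negP => /predU1P[E|yx].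
      by move: xy; rewrite E ltxx.
    by have := phi_lt _ _ Iy Ix yx; rewrite ltNge (ltW xy).
  apply: increasing_ivt_continuous.
    by move=> _ _ [x Ix <-] [y Iy <-] xy; rewrite !gK //; exact: g_lt.
  move=> _ _ r [x Ix <-] [y Iy <-] xy; rewrite !gK // => rxy.
  have Ir : I r := I_itv _ _ Ix Iy _ rxy.
  exists (phi r); last by split; [exists r|exact: gK].
  have mono u v : I u -> I v -> u <= v -> phi u <= phi v.
    by move=> Iu Iv; rewrite le_eqVlt => /predU1P[-> //|uv]; exact/ltW/phi_lt.
  by case/andP: rxy => xr ry; rewrite !mono.
split.
  exists (phi @` I), phi; split=> //.
  - split=> //; exists (phi x0), (phi y0).
    by split; [exists x0|exists y0|rewrite lt_eqF // phi_lt].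
  - by left=> x y /set_mem Ix /set_mem Iy; exact: phi_lt.
  - by split=> // x Ix; exists x.
apply/subspace_continuousP => x Ix; rewrite /from_subspace.
have M_cvg : M @ within (cube I) (nbhs x) --> M x.
  apply: cvgMr_tmp; apply: (cvg_big add_continuous) => i _.
  apply: (@cvg_within_comp _ _ _ _ I (fun y : 'rV[R]_n => y ord0 i) phi) => //.
    apply: cvg_within_filter; exact: coord_continuous.
  by move/subspace_continuousP: phi_cont; apply.
have g_cvg : g @ within (phi @` I) (nbhs (M x)) --> g (M x).
  move/subspace_continuousP: g_cont; apply; rewrite ME //.
  by exists (F x) => //; exact: F_fun.
rewrite (FE x) //.
apply: cvg_trans (cvg_within_comp _ _ _ _ _ _ _ _ M_cvg _ g_cvg); last first.
  by move=> y Iy; rewrite ME //; exists (F y) => //; exact: F_fun.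
by apply: fmap_within_eq => y /set_mem Iy; rewrite FE.
Qed.
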